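(* Let $n\ge1$ be an integer, let $a,b,m$ be constants, and work where $ae^{mx}+be^{-mx}\neq0$. The operational identity $$\prod_{k=n}^{0}\left(D-km\frac{ae^{mx}-be^{-mx}}{ae^{mx}+be^{-mx}}\right)=\left(ae^{mx}+be^{-mx}\right)^{n+1}\left(\frac1{ae^{mx}+be^{-mx}}D\right)^{n+1}$$ holds, and: (i) by virtue of this identity, the equation $$y_n''-\left(\lambda-\frac{4abm^2n(n+1)}{(ae^{mx}+be^{-mx})^2}\right)y_n=0,\qquad \lambda\neq0,$$ has general solution $$y_n=\left(ae^{mx}+be^{-mx}\right)^{n+1}\left(\frac1{ae^{mx}+be^{-mx}}D\right)^{n+1}y_0,$$ where $y_0$ is the general solution of $y_0''-\lambda y_0=0$, taken in one of its exponential, hyperbolic or trigonometric forms; (ii) if $\lambda=m^2(n+1)^2$, then by virtue of the factorization $$D^2-m^2(n+1)^2+\frac{4abm^2n(n+1)}{(ae^{mx}+be^{-mx})^2}=\left[D+m(n+1)\frac{ae^{mx}-be^{-mx}}{ae^{mx}+be^{-mx}}\right]\left[D-m(n+1)\frac{ae^{mx}-be^{-mx}}{ae^{mx}+be^{-mx}}\right]$$ the equation $$y''-m^2(n+1)^2y+\frac{4abm^2n(n+1)}{(ae^{mx}+be^{-mx})^2}y=0$$ has general solution $$y=\left(ae^{mx}+be^{-mx}\right)^{n+1}\left[c_1+c_2\int\left(ae^{mx}+be^{-mx}\right)^{-2(n+1)}dx\right].$$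
   Context: $D=d/dx$. A product $\prod_{k=n}^{0}L_k$ denotes the composition $L_nL_{n-1}\cdots L_0$ ($L_0$ is applied first). Functions act by multiplication, so $\frac1fD$ sends $y$ to $y'/f$. The forms of $y_0$ are $y_0=c_1e^{\sqrt\lambda x}+c_2e^{-\sqrt\lambda x}$; $y_0=c_1\cosh(\sqrt\lambda x)+c_2\sinh(\sqrt\lambda x)$ for $\lambda>0$; $y_0=c_1\cos(\sqrt{-\lambda}x)+c_2\sin(\sqrt{-\lambda}x)$ for $\lambda<0$. Here and in (ii), $c_1,c_2$ are arbitrary constants, and $\int$ denotes an antiderivative.
   Formalization: In (i), every y_n of the given form is shown to be a solution for all λ≠0, but that it is the general solution (every solution has this form) is claimed only when λ≠k²m² for 1≤k≤n; for those excluded λ the claim fails (e.g. n=a=m=λ=1, b=0). *)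

(* Defs.v *)
From Stdlib Require Import Reals.
From Coquelicot Require Import Coquelicot.

Open Scope C_scope.

(** The variable [x] is real; constants and functions take values in a field of
    scalars, which is either [R] (seen inside [C]) or [C]. *)
Inductive scalar_field : Set := real_scalars | complex_scalars.

Definition is_scalar (K : scalar_field) (z : C) : Prop :=
  match K with
  | real_scalars => Im z = 0%R
  | complex_scalars => True
  end.

Definition Rbar_interval (lo hi : Rbar) (x : R) : Prop :=
  Rbar_lt lo x /\ Rbar_lt x hi.

Definition Cexp (z : C) : C :=
  ((exp (Re z) * cos (Im z))%R, (exp (Re z) * sin (Im z))%R).

(** [d/dx] as a total operator (junk value where the function is not
    differentiable), in the style of Coquelicot's [Derive]; see [Cderiv_correct] and
    [Cderiv_unique] for the link with [is_derive]. *)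
Definition Cderiv (y : R -> C) : R -> C :=
  fun x => (Derive (fun t => Re (y t)) x, Derive (fun t => Im (y t)) x).

Definition differentiable_at (y : R -> C) (x : R) : Prop :=
  @ex_derive R_AbsRing C_R_NormedModule y x.

Lemma Cderiv_unique (y : R -> C) (x : R) (l : C) :
  @is_derive R_AbsRing C_R_NormedModule y x l -> Cderiv y x = l.
Proof.
  intros H. destruct l as [l1 l2]. unfold Cderiv. f_equal; apply is_derive_unique.
  - assert (E := filterdiff_comp y (fst : C_R_NormedModule -> R_NormedModule)
      _ _ H (filterdiff_linear _ (@is_linear_fst R_AbsRing R_NormedModule R_NormedModule))).
    exact E.
  - assert (E := filterdiff_comp y (snd : C_R_NormedModule -> R_NormedModule)
      _ _ H (filterdiff_linear _ (@is_linear_snd R_AbsRing R_NormedModule R_NormedModule))).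
    exact E.
Qed.

Lemma Cderiv_correct (y : R -> C) (x : R) :
  differentiable_at y x -> @is_derive R_AbsRing C_R_NormedModule y x (Cderiv y x).
Proof.
  intros [l Hl]. rewrite (Cderiv_unique y x l Hl). exact Hl.
Qed.

(** [k] times differentiable at every point of [I]. *)
Definition differentiable_n (k : nat) (I : R -> Prop) (y : R -> C) : Prop :=
  forall j x, (j < k)%nat -> I x -> differentiable_at (Nat.iter j Cderiv y) x.

(** [L n o ... o L 1 o L 0] *)
Fixpoint descending_product (L : nat -> (R -> C) -> (R -> C)) (n : nat)
    (y : R -> C) : R -> C :=
  match n with
  | O => L O y
  | S p => L (S p) (descending_product L p y)
  end.

Definition fsum (a b m : C) (x : R) : C :=
  a * Cexp (m * x) + b * Cexp (- m * x).

Definition fdiff (a b m : C) (x : R) : C :=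
  a * Cexp (m * x) - b * Cexp (- m * x).

(** [(a e^(mx) + b e^(-mx))^(n+1) ((a e^(mx) + b e^(-mx))^(-1) d/dx)^(n+1)] *)
Definition power_operator (a b m : C) (n : nat) (y : R -> C) : R -> C :=
  fun x => fsum a b m x ^ (n + 1) *
    Nat.iter (n + 1) (fun z t => 1 / fsum a b m t * Cderiv z t) y x.

Definition potential (a b m : C) (n : nat) (x : R) : C :=
  4 * a * b * m ^ 2 * INR n * (INR n + 1) / fsum a b m x ^ 2.

(** [y] is a [K]-valued solution of the second-order equation [L y = 0] on [I]. *)
Definition solution (K : scalar_field) (I : R -> Prop)
    (L : (R -> C) -> (R -> C)) (y : R -> C) : Prop :=
  (forall x, I x -> is_scalar K (y x)) /\
  differentiable_n 2 I y /\
  (forall x, I x -> L y x = 0).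

Definition family_of_solutions (K : scalar_field) (I : R -> Prop)
    (L : (R -> C) -> (R -> C)) (Y : C -> C -> R -> C) : Prop :=
  forall c1 c2, is_scalar K c1 -> is_scalar K c2 -> solution K I L (Y c1 c2).

(** Every [Y c1 c2] is a solution and every solution is some [Y c1 c2]. *)
Definition general_solution (K : scalar_field) (I : R -> Prop)
    (L : (R -> C) -> (R -> C)) (Y : C -> C -> R -> C) : Prop :=
  forall y, solution K I L y <->
    exists c1 c2, is_scalar K c1 /\ is_scalar K c2 /\
      forall x, I x -> y x = Y c1 c2 x.

(** The forms of the solution of [y'' - lambda y = 0].  In the exponential form
    [s] is any square root of [lambda] among the scalars, so over [C] this form
    is available for every [lambda]; over [R] it requires [lambda > 0]. *)
Inductive free_form (K : scalar_field) (lambda : C) : (C -> C -> R -> C) -> Prop :=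
| exponential_form (s : C) :
    is_scalar K s -> s ^ 2 = lambda ->
    free_form K lambda
      (fun c1 c2 x => c1 * Cexp (s * x) + c2 * Cexp (- s * x))
| hyperbolic_form (l : R) :
    lambda = RtoC l -> (0 < l)%R ->
    free_form K lambda
      (fun c1 c2 x => c1 * cosh (sqrt l * x) + c2 * sinh (sqrt l * x))
| trigonometric_form (l : R) :
    lambda = RtoC l -> (l < 0)%R ->
    free_form K lambda
      (fun c1 c2 x => c1 * cos (sqrt (- l) * x) + c2 * sin (sqrt (- l) * x)).

Definition primitive_on (K : scalar_field) (I : R -> Prop) (f G : R -> C) : Prop :=
  forall x, I x -> is_scalar K (G x) /\
    @is_derive R_AbsRing C_R_NormedModule G x (f x).

(* Main.v *)
Require Import Defs.
From Stdlib Require Import Reals.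
From Coquelicot Require Import Coquelicot.
From Stdlib Require Import Lra Lia Classical.
Open Scope C_scope.

(** Write [f = a e^(mx) + b e^(-mx)], [g = a e^(mx) - b e^(-mx)] and [t = g / f].
    Since [f' = m g], [g' = m f] and [f^2 - g^2 = 4 a b], the function [t] satisfies
    the Riccati equation [t' = m (1 - t^2) = 4 a b m / f^2].

    Operational identity.  Because [f' / f = m t], the factor [D - k m t] is
    [f^k D f^(-k)]; in the product of these factors the neighbouring powers of [f]
    combine to single factors [1 / f] ([power_operator_ladder]).

    Solutions.  Suppose [y'' = q y] and [q = mu + h' + h^2] with a constant [mu].  Then
    [z = y' - h y] satisfies [z' = mu y - h z], and hence [z'' = (mu - h' + h^2) z]
    ([darboux_step]).  For [h = k m t] and [mu = lambda - m^2 k^2] the coefficient [q] is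
    [lambda - 4 a b m^2 (k - 1) k / f^2] and the new one is
    [lambda - 4 a b m^2 k (k + 1) / f^2].  So the factors [k = 0, 1, ..., n], applied in
    turn to a solution of [y'' = lambda y], climb a ladder of equations that ends with
    the required one ([solves_ladder]).

    Completeness.  Two solutions with a nonvanishing Wronskian [W] span all solutions,
    since the coefficients given by Cramer's rule are quotients of Wronskians, which are
    constant ([general_solution_of_pair]).  A step of the ladder multiplies [W] by
    [- mu] ([wronskian_darboux]), and [mu] is nonzero for [k = 0] because [lambda] is, and
    for [1 <= k <= n] by the side condition.

    In the case [lambda = m^2 (n + 1)^2] the constant [mu] of the step [k = n + 1]
    vanishes, so that the operator factors as [(D + h) (D - h)] with [h = (n + 1) m t]
    ([factorization]).  The function [u = f^(n+1)] is annihilated by [D - h], and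
    [u] times a primitive of [u^(-2)] is a second solution, with Wronskian 1
    ([solves_primitive_pair]). *)

(** * Derivatives of complex-valued functions of a real variable *)

(** Fixing the normed-module structure here lets the elaborator read [l] in [C]. *)
Definition is_deriv (y : R -> C) (x : R) (l : C) : Prop :=
  @is_derive R_AbsRing C_R_NormedModule y x l.

Lemma is_deriv_components (y : R -> C) (x : R) (l : C) :
  is_deriv y x l <->
  is_derive (fun t => Re (y t)) x (Re l) /\ is_derive (fun t => Im (y t)) x (Im l).
Proof.
  split.
  - intros H; split.
    + exact (filterdiff_comp y (fst : C_R_NormedModule -> R_NormedModule)
        _ _ H (filterdiff_linear _ (@is_linear_fst R_AbsRing R_NormedModule R_NormedModule))).
    + exact (filterdiff_comp y (snd : C_R_NormedModule -> R_NormedModule)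
        _ _ H (filterdiff_linear _ (@is_linear_snd R_AbsRing R_NormedModule R_NormedModule))).
  - intros [H1 H2]. unfold is_derive in *.
    apply (filterdiff_ext (U := R_NormedModule) (V := C_R_NormedModule)
      (fun t : R => (Re (y t), Im (y t)))).
    { intros t; symmetry; apply surjective_pairing. }
    apply (filterdiff_ext_lin (U := R_NormedModule) (V := C_R_NormedModule) _
      (fun t : R => (scal t (Re l), scal t (Im l)))).
    2: { intros t; reflexivity. }
    apply (filterdiff_comp'_2 (T := R_NormedModule) (U := R_NormedModule)
      (V := R_NormedModule) (W := C_R_NormedModule)
      (fun t : R => Re (y t)) (fun t : R => Im (y t)) (fun p q : R => (p, q)) x
      (fun t : R => scal t (Re l)) (fun t : R => scal t (Im l))
      (fun p q : R => (p, q)) H1 H2).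
    apply (filterdiff_ext (K := R_AbsRing) (U := C_R_NormedModule)
      (V := C_R_NormedModule) (fun t : C => t)); [intros [p q]; reflexivity|].
    apply (filterdiff_ext_lin (K := R_AbsRing) (U := C_R_NormedModule)
      (V := C_R_NormedModule) _ (fun t : C => t)); [|intros [p q]; reflexivity].
    apply (filterdiff_id (K := R_AbsRing) (V := C_R_NormedModule)).
Qed.

Lemma is_deriv_eq (y : R -> C) (x : R) (l l' : C) :
  is_deriv y x l -> l = l' -> is_deriv y x l'.
Proof. intros H <-; exact H. Qed.

Lemma is_deriv_RtoC (g : R -> R) (x l : R) :
  is_derive g x l -> is_deriv (fun t => RtoC (g t)) x (RtoC l).
Proof.
  intros H; apply is_deriv_components; split; simpl; [exact H|].
  apply (is_derive_const (K := R_AbsRing) (V := R_NormedModule)).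
Qed.

Lemma is_deriv_const (c : C) (x : R) : is_deriv (fun _ => c) x 0.
Proof. exact (is_derive_const (K := R_AbsRing) (V := C_R_NormedModule) c x). Qed.

Lemma is_deriv_plus (y z : R -> C) (x : R) (l k : C) :
  is_deriv y x l -> is_deriv z x k -> is_deriv (fun t => y t + z t) x (l + k).
Proof. intros; apply (is_derive_plus (K := R_AbsRing) (V := C_R_NormedModule)); assumption. Qed.

Lemma is_deriv_minus (y z : R -> C) (x : R) (l k : C) :
  is_deriv y x l -> is_deriv z x k -> is_deriv (fun t => y t - z t) x (l - k).
Proof. intros; apply (is_derive_minus (K := R_AbsRing) (V := C_R_NormedModule)); assumption. Qed.

Lemma is_deriv_mult (y z : R -> C) (x : R) (l k : C) :
  is_deriv y x l -> is_deriv z x k ->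
  is_deriv (fun t => y t * z t) x (l * z x + y x * k).
Proof.
  rewrite !is_deriv_components.
  assert (E : forall (f g : R -> R) (df dg : R), is_derive f x df -> is_derive g x dg ->
    is_derive (fun t => f t * g t)%R x (df * g x + f x * dg)%R).
  { intros f g df dg Hf Hg; apply (is_derive_mult f g x df dg Hf Hg).
    intros; apply Rmult_comm. }
  intros [H1 H2] [H3 H4]; split; simpl.
  - replace (_ + _)%R with
      ((Re l * Re (z x) + Re (y x) * Re k) - (Im l * Im (z x) + Im (y x) * Im k))%R
      by (unfold Re, Im; ring).
    apply (is_derive_minus (K := R_AbsRing) (V := R_NormedModule)); apply E; assumption.
  - replace (_ + _)%R with
      ((Re l * Im (z x) + Re (y x) * Im k) + (Im l * Re (z x) + Im (y x) * Re k))%R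
      by (unfold Re, Im; ring).
    apply (is_derive_plus (K := R_AbsRing) (V := R_NormedModule)); apply E; assumption.
Qed.

Lemma is_deriv_scal (c : C) (y : R -> C) (x : R) (l : C) :
  is_deriv y x l -> is_deriv (fun t => c * y t) x (c * l).
Proof.
  intros H; eapply is_deriv_eq; [exact (is_deriv_mult _ _ _ _ _ (is_deriv_const c x) H)|].
  simpl; ring.
Qed.

Lemma Cnorm2_pos (z : C) : z <> 0 -> (0 < fst z ^ 2 + snd z ^ 2)%R.
Proof.
  intros H; apply Rnot_le_lt; intros Hle; apply H.
  assert (E := pow2_ge_0 (fst z)); assert (E' := pow2_ge_0 (snd z)).
  apply injective_projections; simpl; nra.
Qed.

Lemma is_deriv_inv (y : R -> C) (x : R) (l : C) :
  y x <> 0 -> is_deriv y x l -> is_deriv (fun t => / y t) x (- l / (y x) ^ 2).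
Proof.
  intros Hx; rewrite !is_deriv_components.
  assert (N := Cnorm2_pos _ Hx).
  (* With [f = Re y], [g = Im y] this is the real part of [1 / y]; with the roles
     exchanged it is minus the imaginary part. *)
  assert (E : forall (f g : R -> R) (df dg : R), is_derive f x df -> is_derive g x dg ->
    (0 < f x ^ 2 + g x ^ 2)%R ->
    is_derive (fun t => f t / (f t ^ 2 + g t ^ 2))%R x
      ((df * (f x ^ 2 + g x ^ 2) - f x * (2 * f x * df + 2 * g x * dg))
       / (f x ^ 2 + g x ^ 2) ^ 2)%R).
  { intros f g df dg Hf Hg P; auto_derive.
    - repeat split; try (eexists; eassumption). simpl in P; lra.
    - replace (Derive _ x) with df by (symmetry; exact (is_derive_unique f x df Hf)).
      replace (Derive _ x) with dg by (symmetry; exact (is_derive_unique g x dg Hg)).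
      field; simpl in P |- *; lra. }
  intros [H1 H2].
  replace (- l / y x ^ 2) with (- l * (/ y x * / y x)) by (field; exact Hx).
  split.
  - replace (Re _) with
      ((Re l * (Re (y x) ^ 2 + Im (y x) ^ 2) - Re (y x) *
         (2 * Re (y x) * Re l + 2 * Im (y x) * Im l))
       / (Re (y x) ^ 2 + Im (y x) ^ 2) ^ 2)%R.
    + exact (E _ _ _ _ H1 H2 N).
    + unfold Re, Im; simpl; field; simpl in N; lra.
  - apply (is_derive_ext (K := R_AbsRing) (V := R_NormedModule)
      (fun t => - (Im (y t) / (Im (y t) ^ 2 + Re (y t) ^ 2)))%R).
    { intros t; unfold Re, Im; simpl; unfold Rdiv; rewrite Ropp_mult_distr_l.
      do 2 f_equal; ring. }
    rewrite Rplus_comm in N.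
    replace (Im _) with
      (- ((Im l * (Im (y x) ^ 2 + Re (y x) ^ 2) - Im (y x) *
         (2 * Im (y x) * Im l + 2 * Re (y x) * Re l))
       / (Im (y x) ^ 2 + Re (y x) ^ 2) ^ 2))%R.
    + apply (is_derive_opp (K := R_AbsRing) (V := R_NormedModule)).
      exact (E _ _ _ _ H2 H1 N).
    + unfold Re, Im; simpl; field; simpl in N; lra.
Qed.

Lemma is_deriv_pow (y : R -> C) (x : R) (l : C) (n : nat) :
  is_deriv y x l -> is_deriv (fun t => y t ^ S n) x (INR (S n) * y x ^ n * l).
Proof.
  intros H; induction n as [|n IH].
  - apply (is_derive_ext (K := R_AbsRing) (V := C_R_NormedModule) y).
    { intros t; simpl; symmetry; apply Cmult_1_r. }
    eapply is_deriv_eq; [exact H|change (INR 1) with 1%R; simpl Cpow; ring].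
  - eapply is_deriv_eq; [exact (is_deriv_mult _ _ _ _ _ H IH)|].
    rewrite (S_INR (S n)), RtoC_plus, Cpow_S; ring.
Qed.

Lemma is_deriv_Cexp (s : C) (x : R) :
  is_deriv (fun t => Cexp (s * t)) x (s * Cexp (s * x)).
Proof.
  apply is_deriv_components; split; simpl; auto_derive; auto;
  unfold Re, Im; simpl; unfold Rminus; ring.
Qed.

Lemma is_deriv_Cderiv (y : R -> C) (x : R) (l : C) : is_deriv y x l -> Cderiv y x = l.
Proof. apply Cderiv_unique. Qed.

Lemma differentiable_is_deriv (y : R -> C) (x : R) :
  differentiable_at y x -> is_deriv y x (Cderiv y x).
Proof. apply Cderiv_correct. Qed.

Lemma is_deriv_differentiable (y : R -> C) (x : R) (l : C) :
  is_deriv y x l -> differentiable_at y x.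
Proof. intros H; exists l; exact H. Qed.

(** * Functions on an open set *)

Lemma open_Rbar_interval (lo hi : Rbar) : open (Rbar_interval lo hi).
Proof. apply open_and; [apply open_Rbar_gt | apply open_Rbar_lt]. Qed.

Lemma is_deriv_ext_open (I : R -> Prop) (y z : R -> C) (x : R) (l : C) :
  open I -> I x -> (forall t, I t -> y t = z t) -> is_deriv y x l -> is_deriv z x l.
Proof.
  intros HI Hx E; apply is_derive_ext_loc.
  exact (filter_imp _ _ E (HI x Hx)).
Qed.

Lemma Cderiv_ext_open (I : R -> Prop) (y z : R -> C) (x : R) :
  open I -> I x -> (forall t, I t -> y t = z t) -> Cderiv y x = Cderiv z x.
Proof.
  intros HI Hx E; unfold Cderiv; f_equal; apply Derive_ext_loc;
    apply (filter_imp _ _ (fun t Ht => f_equal _ (E t Ht)) (HI x Hx)).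
Qed.

Lemma constant_of_zero_derivative (lo hi : Rbar) (y : R -> C) :
  (forall x, Rbar_interval lo hi x -> is_deriv y x 0) ->
  forall x x', Rbar_interval lo hi x -> Rbar_interval lo hi x' -> y x = y x'.
Proof.
  intros H.
  assert (W : forall x x', (x < x')%R ->
    Rbar_interval lo hi x -> Rbar_interval lo hi x' -> y x = y x').
  { intros x x' Hlt [Hx _] [_ Hx'].
    apply (eq_is_derive (V := C_R_NormedModule)); [|exact Hlt].
    intros t [Ht Ht']; apply H; split.
    - apply (Rbar_lt_le_trans _ x); assumption.
    - apply (Rbar_le_lt_trans _ x'); assumption. }
  intros x x' Hx Hx'; destruct (Rtotal_order x x') as [Hlt|[<-|Hlt]].
  - now apply W.
  - reflexivity.
  - symmetry; now apply W.
Qed.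

(** * Repeated differentiability *)

Lemma differentiable_n_S (k : nat) (I : R -> Prop) (y : R -> C) :
  differentiable_n (S k) I y <->
  (forall x, I x -> differentiable_at y x) /\ differentiable_n k I (Cderiv y).
Proof.
  split.
  - intros H; split.
    + intros x Hx; apply (H 0%nat x); [lia|exact Hx].
    + intros j x Hj Hx; rewrite <- Nat.iter_succ_r; apply H; [lia|exact Hx].
  - intros [H0 H] [|j] x Hj Hx; [now apply H0|].
    rewrite Nat.iter_succ_r; apply H; [lia|exact Hx].
Qed.

Lemma differentiable_n_ext (k : nat) (I : R -> Prop) (y z : R -> C) :
  open I -> (forall x, I x -> y x = z x) ->
  differentiable_n k I y -> differentiable_n k I z.
Proof.
  intros HI; revert y z; induction k as [|k IH]; intros y z E H.
  { intros j x Hj; lia. }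
  apply differentiable_n_S in H; destruct H as [H0 H]; apply differentiable_n_S; split.
  - intros x Hx; apply is_deriv_differentiable with (Cderiv y x).
    apply (is_deriv_ext_open I y z x); auto using differentiable_is_deriv.
  - apply (IH (Cderiv y)); [|exact H].
    intros x Hx; now apply (Cderiv_ext_open I).
Qed.

Lemma differentiable_n_pred (k : nat) (I : R -> Prop) (y : R -> C) :
  differentiable_n (S k) I y -> differentiable_n k I y.
Proof. intros H j x Hj; apply H; lia. Qed.

Lemma differentiable_n_intro (k : nat) (I : R -> Prop) (y dy : R -> C) :
  open I -> (forall x, I x -> is_deriv y x (dy x)) ->
  differentiable_n k I dy -> differentiable_n (S k) I y.
Proof.
  intros HI D H; apply differentiable_n_S; split.
  - intros x Hx; exact (is_deriv_differentiable _ _ _ (D x Hx)).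
  - apply (differentiable_n_ext k I dy); auto.
    intros x Hx; symmetry; apply is_deriv_Cderiv; auto.
Qed.

Lemma differentiable_n_const (k : nat) (I : R -> Prop) (c : C) :
  open I -> differentiable_n k I (fun _ => c).
Proof.
  intros HI; revert c; induction k as [|k IH]; intros c.
  { intros j x Hj; lia. }
  apply (differentiable_n_intro k I _ (fun _ => 0)); auto.
  intros x _; apply is_deriv_const.
Qed.

Lemma differentiable_n_minus (k : nat) (I : R -> Prop) (y z : R -> C) :
  open I -> differentiable_n k I y -> differentiable_n k I z ->
  differentiable_n k I (fun t => y t - z t).
Proof.
  intros HI; revert y z; induction k as [|k IH]; intros y z Hy Hz.
  { intros j x Hj; lia. }
  apply differentiable_n_S in Hy, Hz; destruct Hy as [Dy Hy], Hz as [Dz Hz].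
  apply (differentiable_n_intro k I _ (fun t => Cderiv y t - Cderiv z t)); auto.
  intros x Hx; apply is_deriv_minus; apply differentiable_is_deriv; auto.
Qed.

Lemma differentiable_n_plus (k : nat) (I : R -> Prop) (y z : R -> C) :
  open I -> differentiable_n k I y -> differentiable_n k I z ->
  differentiable_n k I (fun t => y t + z t).
Proof.
  intros HI; revert y z; induction k as [|k IH]; intros y z Hy Hz.
  { intros j x Hj; lia. }
  apply differentiable_n_S in Hy, Hz; destruct Hy as [Dy Hy], Hz as [Dz Hz].
  apply (differentiable_n_intro k I _ (fun t => Cderiv y t + Cderiv z t)); auto.
  intros x Hx; apply is_deriv_plus; apply differentiable_is_deriv; auto.
Qed.

Lemma differentiable_n_mult (k : nat) (I : R -> Prop) (y z : R -> C) :
  open I -> differentiable_n k I y -> differentiable_n k I z ->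
  differentiable_n k I (fun t => y t * z t).
Proof.
  intros HI; revert y z; induction k as [|k IH]; intros y z Hy Hz.
  { intros j x Hj; lia. }
  assert (Hy' := differentiable_n_pred _ _ _ Hy).
  assert (Hz' := differentiable_n_pred _ _ _ Hz).
  apply differentiable_n_S in Hy, Hz; destruct Hy as [Dy Hy], Hz as [Dz Hz].
  apply (differentiable_n_intro k I _ (fun t => Cderiv y t * z t + y t * Cderiv z t)); auto.
  - intros x Hx; apply is_deriv_mult; apply differentiable_is_deriv; auto.
  - apply differentiable_n_plus; auto; now apply IH.
Qed.

(** * Closure properties of the scalars *)

Lemma scalar_RtoC (K : scalar_field) (r : R) : is_scalar K (RtoC r).
Proof. destruct K; [reflexivity|exact Logic.I]. Qed.

Lemma scalar_plus (K : scalar_field) (z w : C) :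
  is_scalar K z -> is_scalar K w -> is_scalar K (z + w).
Proof. destruct K; [|easy]; unfold is_scalar, Im; simpl; intros; lra. Qed.

Lemma scalar_opp (K : scalar_field) (z : C) : is_scalar K z -> is_scalar K (- z).
Proof. destruct K; [|easy]; unfold is_scalar, Im; simpl; intros; lra. Qed.

Lemma scalar_minus (K : scalar_field) (z w : C) :
  is_scalar K z -> is_scalar K w -> is_scalar K (z - w).
Proof. intros; apply scalar_plus; auto using scalar_opp. Qed.

Lemma scalar_mult (K : scalar_field) (z w : C) :
  is_scalar K z -> is_scalar K w -> is_scalar K (z * w).
Proof. destruct K; [|easy]; unfold is_scalar, Im; simpl; intros -> ->; ring. Qed.

Lemma scalar_inv (K : scalar_field) (z : C) : is_scalar K z -> is_scalar K (/ z).
Proof.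
  destruct K; [|easy]; unfold is_scalar, Im; simpl; intros ->.
  unfold Rdiv; rewrite Ropp_0; apply Rmult_0_l.
Qed.

Lemma scalar_div (K : scalar_field) (z w : C) :
  is_scalar K z -> is_scalar K w -> is_scalar K (z / w).
Proof. intros; apply scalar_mult; auto using scalar_inv. Qed.

Lemma scalar_pow (K : scalar_field) (z : C) (n : nat) : is_scalar K z -> is_scalar K (z ^ n).
Proof.
  intros H; induction n as [|n IH]; simpl; [apply scalar_RtoC | now apply scalar_mult].
Qed.

Lemma scalar_Cexp (K : scalar_field) (z : C) : is_scalar K z -> is_scalar K (Cexp z).
Proof. destruct K; [|easy]; unfold is_scalar, Cexp, Im; simpl; intros ->; rewrite sin_0; ring. Qed.

(** Openness makes the imaginary part vanish near [x], not only at [x]. *)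
Lemma scalar_Cderiv (K : scalar_field) (I : R -> Prop) (y : R -> C) (x : R) :
  open I -> I x -> (forall t, I t -> is_scalar K (y t)) -> is_scalar K (Cderiv y x).
Proof.
  intros HI Hx H; destruct K; [|exact Logic.I]; simpl in *.
  rewrite (Derive_ext_loc _ (fun _ => 0%R)); [apply Derive_const|].
  exact (filter_imp _ _ H (HI x Hx)).
Qed.

Create HintDb scalars.
#[local] Hint Resolve scalar_RtoC scalar_plus scalar_opp scalar_minus scalar_mult scalar_inv
  scalar_div scalar_pow scalar_Cexp : scalars.

(** * Linear equations of the second order *)

(** The equation [y'' = q y] on [I], with the differentiability of [y] and [y'] included. *)
Definition solves (I : R -> Prop) (q y : R -> C) : Prop :=
  forall x, I x -> is_deriv y x (Cderiv y x) /\ is_deriv (Cderiv y) x (q x * y x).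

Definition wronskian (u v : R -> C) (x : R) : C := u x * Cderiv v x - Cderiv u x * v x.

Lemma solves_intro (I : R -> Prop) (q y y1 : R -> C) :
  open I -> (forall x, I x -> is_deriv y x (y1 x)) ->
  (forall x, I x -> is_deriv y1 x (q x * y x)) -> solves I q y.
Proof.
  intros HI H H1 x Hx.
  assert (E : forall t, I t -> y1 t = Cderiv y t).
  { intros t Ht; symmetry; now apply is_deriv_Cderiv, H. }
  split; [rewrite <- E; auto|].
  apply (is_deriv_ext_open I y1); auto.
Qed.

Lemma solves_coefficient_ext (I : R -> Prop) (q r y : R -> C) :
  (forall x, I x -> q x = r x) -> solves I q y -> solves I r y.
Proof. intros E H x Hx; rewrite <- E by exact Hx; auto. Qed.

Lemma solves_ext (I : R -> Prop) (q y z : R -> C) :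
  open I -> (forall x, I x -> y x = z x) -> solves I q y -> solves I q z.
Proof.
  intros HI E H; apply (solves_intro I q z (Cderiv y)); auto; intros x Hx.
  - apply (is_deriv_ext_open I y); auto; now apply H.
  - rewrite <- E by exact Hx; now apply H.
Qed.

Lemma solves_combination (I : R -> Prop) (q u v : R -> C) (c1 c2 : C) :
  open I -> solves I q u -> solves I q v ->
  solves I q (fun x => c1 * u x + c2 * v x).
Proof.
  intros HI Hu Hv.
  apply (solves_intro I q _ (fun x => c1 * Cderiv u x + c2 * Cderiv v x)); auto;
    intros x Hx; destruct (Hu x Hx), (Hv x Hx).
  - now apply is_deriv_plus; apply is_deriv_scal.
  - eapply is_deriv_eq; [apply is_deriv_plus; apply is_deriv_scal; eassumption|]; ring.
Qed.

Lemma solution_iff_solves (K : scalar_field) (I : R -> Prop)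
    (L : (R -> C) -> (R -> C)) (q y : R -> C) :
  (forall z x, I x -> L z x = Cderiv (Cderiv z) x - q x * z x) ->
  solution K I L y <-> (forall x, I x -> is_scalar K (y x)) /\ solves I q y.
Proof.
  intros HL; split.
  - intros (HK & HD & H0); split; [exact HK|]; intros x Hx.
    assert (D0 := HD 0%nat x ltac:(lia) Hx); assert (D1 := HD 1%nat x ltac:(lia) Hx).
    simpl in D0, D1; split; [now apply differentiable_is_deriv|].
    apply is_deriv_eq with (Cderiv (Cderiv y) x); [now apply differentiable_is_deriv|].
    apply Ceq_minus; rewrite <- HL; auto.
  - intros (HK & H); repeat split; [exact HK| |].
    + intros [|[|j]] x Hj Hx; [| |lia]; destruct (H x Hx) as [H0 H1];
        eapply is_deriv_differentiable; simpl; eassumption.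
    + intros x Hx; rewrite HL, (is_deriv_Cderiv _ _ _ (proj2 (H x Hx))) by exact Hx; ring.
Qed.

(** The equation has no first-order term, so [(u v' - u' v)' = u q v - q u v = 0]. *)
Lemma wronskian_constant (lo hi : Rbar) (q u v : R -> C) :
  let I := Rbar_interval lo hi in
  solves I q u -> solves I q v ->
  forall x x', I x -> I x' -> wronskian u v x = wronskian u v x'.
Proof.
  intros I Hu Hv; apply constant_of_zero_derivative; intros x Hx.
  destruct (Hu x Hx), (Hv x Hx).
  eapply is_deriv_eq; [apply is_deriv_minus; apply is_deriv_mult; eassumption|]; ring.
Qed.

Lemma family_of_pair (K : scalar_field) (I : R -> Prop)
    (L : (R -> C) -> (R -> C)) (q u v : R -> C) (Y : C -> C -> R -> C) :
  open I ->
  (forall z x, I x -> L z x = Cderiv (Cderiv z) x - q x * z x) ->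
  (forall x, I x -> is_scalar K (u x)) -> (forall x, I x -> is_scalar K (v x)) ->
  solves I q u -> solves I q v ->
  (forall c1 c2 x, I x -> Y c1 c2 x = c1 * u x + c2 * v x) ->
  family_of_solutions K I L Y.
Proof.
  intros HI HL Ku Kv Hu Hv HY c1 c2 K1 K2.
  apply (solution_iff_solves K I L q); auto; split.
  - intros x Hx; rewrite HY by exact Hx; auto with scalars.
  - apply (solves_ext I q (fun x => c1 * u x + c2 * v x)); auto.
    + intros x Hx; symmetry; auto.
    + now apply solves_combination.
Qed.

(** By Cramer's rule the coordinates of a solution [y] are [W(y, v) / W(u, v)] and
    [W(u, y) / W(u, v)], and both are constant.  They are scalars because Wronskians of
    [K]-valued functions are [K]-valued. *)
Lemma general_solution_of_pair (K : scalar_field) (lo hi : Rbar)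
    (L : (R -> C) -> (R -> C)) (q u v : R -> C) (Y : C -> C -> R -> C) :
  let I := Rbar_interval lo hi in
  (forall z x, I x -> L z x = Cderiv (Cderiv z) x - q x * z x) ->
  (forall x, I x -> is_scalar K (u x)) -> (forall x, I x -> is_scalar K (v x)) ->
  solves I q u -> solves I q v ->
  (forall x, I x -> wronskian u v x <> 0) ->
  (forall c1 c2 x, I x -> Y c1 c2 x = c1 * u x + c2 * v x) ->
  general_solution K I L Y.
Proof.
  intros I HL Ku Kv Hu Hv HW HY y.
  assert (HI : open I) by apply open_Rbar_interval.
  split.
  - intros Hy; apply (solution_iff_solves K I L q) in Hy; [|exact HL].
    destruct Hy as [Ky Hy].
    destruct (classic (exists x0, I x0)) as [[x0 H0]|Hempty].
    + assert (KW : forall w z, (forall x, I x -> is_scalar K (w x)) ->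
        (forall x, I x -> is_scalar K (z x)) -> is_scalar K (wronskian w z x0)).
      { intros w z Kw Kz; unfold wronskian.
        assert (is_scalar K (Cderiv w x0)) by now apply (scalar_Cderiv K I).
        assert (is_scalar K (Cderiv z x0)) by now apply (scalar_Cderiv K I).
        auto with scalars. }
      exists (wronskian y v x0 / wronskian u v x0), (wronskian u y x0 / wronskian u v x0).
      repeat split; [auto with scalars | auto with scalars |].
      intros x Hx; rewrite HY by exact Hx.
      rewrite (wronskian_constant lo hi q y v Hy Hv x0 x),
        (wronskian_constant lo hi q u y Hu Hy x0 x),
        (wronskian_constant lo hi q u v Hu Hv x0 x) by assumption.
      specialize (HW x Hx); unfold wronskian in *; field; exact HW.
    (* On an empty interval every function is a solution. *)
    + exists 0, 0; repeat split; try apply scalar_RtoC.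
      intros x Hx; destruct Hempty; now exists x.
  - intros (c1 & c2 & K1 & K2 & E).
    assert (HF := family_of_pair K I L q u v Y HI HL Ku Kv Hu Hv HY c1 c2 K1 K2).
    apply (solution_iff_solves K I L q) in HF; auto; destruct HF as [KF HF].
    apply (solution_iff_solves K I L q); auto; split.
    + intros x Hx; rewrite E; auto.
    + apply (solves_ext I q (Y c1 c2)); auto; intros x Hx; symmetry; auto.
Qed.

(** * First-order factors *)

(** The Darboux transformation: [q = mu + h' + h^2] says that
    [D^2 - q = (D + h) (D - h) - mu], so [D - h] carries solutions of [y'' = q y] to
    solutions of the equation with the two factors exchanged. *)
Lemma darboux_step (I : R -> Prop) (q h h1 y : R -> C) (mu : C) :
  let z := fun x => Cderiv y x - h x * y x in
  open I ->
  (forall x, I x -> is_deriv h x (h1 x)) ->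
  (forall x, I x -> q x = mu + (h1 x + h x ^ 2)) ->
  solves I q y ->
  (forall x, I x -> is_deriv z x (mu * y x - h x * z x)) /\
  solves I (fun x => mu + (h x ^ 2 - h1 x)) z.
Proof.
  intros z HI Hh Hq Hy.
  assert (D : forall x, I x -> is_deriv z x (mu * y x - h x * z x)).
  { intros x Hx; destruct (Hy x Hx) as [H0 H1].
    eapply is_deriv_eq;
      [apply is_deriv_minus; [exact H1 | apply is_deriv_mult; [exact (Hh x Hx) | exact H0]]|].
    unfold z; rewrite Hq by exact Hx; ring. }
  split; [exact D|].
  apply (solves_intro I _ z (fun x => mu * y x - h x * z x)); auto.
  intros x Hx; eapply is_deriv_eq.
  - exact (is_deriv_minus _ _ _ _ _ (is_deriv_scal mu _ _ _ (proj1 (Hy x Hx)))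
      (is_deriv_mult _ _ _ _ _ (Hh x Hx) (D x Hx))).
  - unfold z; ring.
Qed.

(** With [z = y' - h y] and [z' = mu y - h z], the terms in [h] cancel:
    [z1 z2' - z1' z2 = mu (z1 y2 - y1 z2) = - mu (y1 y2' - y1' y2)]. *)
Lemma wronskian_darboux (I : R -> Prop) (q h h1 u v : R -> C) (mu : C) :
  open I ->
  (forall x, I x -> is_deriv h x (h1 x)) ->
  (forall x, I x -> q x = mu + (h1 x + h x ^ 2)) ->
  solves I q u -> solves I q v ->
  forall x, I x ->
    wronskian (fun t => Cderiv u t - h t * u t) (fun t => Cderiv v t - h t * v t) x
    = - mu * wronskian u v x.
Proof.
  intros HI Hh Hq Hu Hv x Hx.
  destruct (darboux_step I q h h1 u mu HI Hh Hq Hu) as [Du _].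
  destruct (darboux_step I q h h1 v mu HI Hh Hq Hv) as [Dv _].
  unfold wronskian.
  rewrite (is_deriv_Cderiv _ _ _ (Du x Hx)), (is_deriv_Cderiv _ _ _ (Dv x Hx)); ring.
Qed.

Lemma factorization (I : R -> Prop) (h h1 y : R -> C) :
  (forall x, I x -> is_deriv h x (h1 x)) -> differentiable_n 2 I y ->
  forall x, I x ->
    Cderiv (Cderiv y) x - (h1 x + h x ^ 2) * y x =
    Cderiv (fun t => Cderiv y t - h t * y t) x + h x * (Cderiv y x - h x * y x).
Proof.
  intros Hh Hy x Hx.
  assert (D0 := Hy 0%nat x ltac:(lia) Hx); assert (D1 := Hy 1%nat x ltac:(lia) Hx).
  simpl in D0, D1; apply differentiable_is_deriv in D0, D1.
  rewrite (is_deriv_Cderiv _ _ _ (is_deriv_minus _ _ _ _ _ D1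
    (is_deriv_mult _ _ _ _ _ (Hh x Hx) D0))); ring.
Qed.

(** * The functions a e^(mx) + b e^(-mx) and a e^(mx) - b e^(-mx) *)

Lemma Cexp_opp (z : C) : Cexp z * Cexp (- z) = 1.
Proof.
  destruct z as [p q]; unfold Cexp, Re, Im; simpl.
  rewrite cos_neg, sin_neg, exp_Ropp.
  assert (P := exp_pos p); assert (T := sin2_cos2 q); unfold Rsqr in T.
  apply injective_projections; simpl; field_simplify; lra.
Qed.

Lemma fsum_fdiff (a b m : C) (x : R) : fsum a b m x ^ 2 - fdiff a b m x ^ 2 = 4 * a * b.
Proof.
  assert (E := Cexp_opp (m * x)).
  replace (- (m * x)) with (- m * x) in E by ring.
  unfold fsum, fdiff.
  transitivity (4 * a * b * (Cexp (m * x) * Cexp (- m * x))); [ring|].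
  rewrite E; ring.
Qed.

Lemma is_deriv_fsum (a b m : C) (x : R) : is_deriv (fsum a b m) x (m * fdiff a b m x).
Proof.
  eapply is_deriv_eq;
    [apply is_deriv_plus; apply is_deriv_scal; apply is_deriv_Cexp|].
  unfold fdiff; ring.
Qed.

Lemma is_deriv_fdiff (a b m : C) (x : R) : is_deriv (fdiff a b m) x (m * fsum a b m x).
Proof.
  eapply is_deriv_eq;
    [apply is_deriv_minus; apply is_deriv_scal; apply is_deriv_Cexp|].
  unfold fsum; ring.
Qed.

(** The logarithmic derivative of [fsum a b m] is [m] times this function. *)
Definition log_slope (a b m : C) (x : R) : C := fdiff a b m x / fsum a b m x.

Lemma is_deriv_log_slope (a b m : C) (x : R) :
  fsum a b m x <> 0 ->
  is_deriv (log_slope a b m) x (m * (1 - log_slope a b m x * log_slope a b m x)).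
Proof.
  intros Hf; eapply is_deriv_eq.
  - apply is_deriv_mult; [apply is_deriv_fdiff|].
    apply is_deriv_inv; [exact Hf | apply is_deriv_fsum].
  - unfold log_slope; field; exact Hf.
Qed.

(** The Riccati equation gives one derivative more at each step of the induction. *)
Lemma smooth_log_slope (a b m : C) (I : R -> Prop) (k : nat) :
  open I -> (forall x, I x -> fsum a b m x <> 0) ->
  differentiable_n k I (log_slope a b m).
Proof.
  intros HI Hf; induction k as [|k IH].
  { intros j x Hj; lia. }
  eapply differentiable_n_intro; [exact HI| |].
  - intros x Hx; apply is_deriv_log_slope; auto.
  - apply differentiable_n_mult; [exact HI | now apply differentiable_n_const|].
    apply differentiable_n_minus; [exact HI | now apply differentiable_n_const|].
    now apply differentiable_n_mult.
Qed.

Lemma is_deriv_scaled_slope (a b m c : C) (x : R) :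
  fsum a b m x <> 0 ->
  is_deriv (fun t => c * m * log_slope a b m t) x
    (4 * a * b * m ^ 2 * c / fsum a b m x ^ 2).
Proof.
  intros Hf; eapply is_deriv_eq.
  - apply is_deriv_scal; apply is_deriv_log_slope; exact Hf.
  - rewrite <- (fsum_fdiff a b m x); unfold log_slope; field; exact Hf.
Qed.

Lemma scaled_slope_square (a b m c : C) (x : R) :
  fsum a b m x <> 0 ->
  (c * m * log_slope a b m x) ^ 2
  = m ^ 2 * c ^ 2 - 4 * a * b * m ^ 2 * c ^ 2 / fsum a b m x ^ 2.
Proof.
  intros Hf; rewrite <- (fsum_fdiff a b m x); unfold log_slope; field; exact Hf.
Qed.

(** * The product of the first-order factors *)

Definition ladder_factor (a b m : C) (k : nat) (y : R -> C) : R -> C :=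
  fun t => Cderiv y t - INR k * m * log_slope a b m t * y t.

Local Notation ladder a b m := (descending_product (ladder_factor a b m)).

Lemma differentiable_n_ladder_factor (a b m : C) (I : R -> Prop) (k j : nat) (y : R -> C) :
  open I -> (forall x, I x -> fsum a b m x <> 0) ->
  differentiable_n (S k) I y -> differentiable_n k I (ladder_factor a b m j y).
Proof.
  intros HI Hf Hy; assert (Hy' := differentiable_n_pred _ _ _ Hy).
  apply differentiable_n_S in Hy; destruct Hy as [_ Hy].
  apply differentiable_n_minus; auto.
  apply differentiable_n_mult; auto.
  apply differentiable_n_mult; [auto | now apply differentiable_n_const|].
  now apply smooth_log_slope.
Qed.

Lemma differentiable_n_ladder (a b m : C) (I : R -> Prop) (n k : nat) (y : R -> C) :
  open I -> (forall x, I x -> fsum a b m x <> 0) ->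
  differentiable_n (S n + k) I y -> differentiable_n k I (ladder a b m n y).
Proof.
  intros HI Hf; revert k; induction n as [|n IH]; intros k Hy.
  - now apply differentiable_n_ladder_factor.
  - apply differentiable_n_ladder_factor; auto.
    apply IH; now rewrite Nat.add_succ_r.
Qed.

(** By induction [((1/f) D)^(n+1) y = f^(-(n+1)) z] with [z] the ladder product:
    differentiating [f^(-(n+1)) z] yields [f^(-(n+1)) (z' - (n+1) (f'/f) z)].  Only the first
    derivatives of the partial products enter, so the lemma serves both arbitrary
    functions with [n + 1] derivatives and solutions of the free equation. *)
Lemma power_operator_ladder (a b m : C) (I : R -> Prop) (n : nat) (y : R -> C) :
  open I -> (forall x, I x -> fsum a b m x <> 0) ->
  (forall x, I x -> differentiable_at y x) ->
  (forall j x, (j < n)%nat -> I x -> differentiable_at (ladder a b m j y) x) ->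
  forall x, I x -> power_operator a b m n y x = ladder a b m n y x.
Proof.
  intros HI Hf Hy Hl.
  assert (E : forall x, I x ->
    Nat.iter (S n) (fun z t => 1 / fsum a b m t * Cderiv z t) y x
    = ladder a b m n y x * / fsum a b m x ^ S n).
  { induction n as [|n IH]; intros x Hx; assert (Hfx := Hf x Hx).
    - simpl; unfold ladder_factor; simpl INR; field; exact Hfx.
    - change (Nat.iter (S (S n)) ?F y x) with
        (1 / fsum a b m x * Cderiv (Nat.iter (S n) F y) x).
      assert (D := differentiable_is_deriv _ _ (Hl n x ltac:(lia) Hx)).
      rewrite (Cderiv_ext_open I _ _ x HI Hx (IH (fun j x Hj => Hl j x ltac:(lia)))).
      rewrite (is_deriv_Cderiv _ _ _ (is_deriv_mult _ _ _ _ _ D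
        (is_deriv_inv _ _ _ (Cpow_nz _ (S n) Hfx) (is_deriv_pow _ _ _ n (is_deriv_fsum a b m x))))).
      simpl descending_product; unfold ladder_factor, log_slope.
      rewrite !Cpow_S; field; split; [now apply Cpow_nz | exact Hfx]. }
  intros x Hx; unfold power_operator; rewrite Nat.add_1_r, E by exact Hx.
  field; apply (Cpow_nz _ (S n)); auto.
Qed.

(** For [h = (k+1) m t] this is [q = mu + (h' + h^2)], where [k (k+1)] arises
    as [(k+1)^2 - (k+1)]. *)
Lemma potential_succ (a b m : C) (k : nat) (lambda : C) (x : R) :
  fsum a b m x <> 0 ->
  lambda - potential a b m k x
  = lambda - m ^ 2 * INR (S k) ^ 2
    + (4 * a * b * m ^ 2 * INR (S k) / fsum a b m x ^ 2
       + (INR (S k) * m * log_slope a b m x) ^ 2).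
Proof.
  intros Hf; rewrite scaled_slope_square by exact Hf.
  unfold potential; rewrite S_INR, RtoC_plus; field; exact Hf.
Qed.

(** For [h = k m t] this is [q = mu + (h^2 - h')], where [k (k+1)] arises as
    [k^2 + k]. *)
Lemma potential_same (a b m : C) (k : nat) (lambda : C) (x : R) :
  fsum a b m x <> 0 ->
  lambda - potential a b m k x
  = lambda - m ^ 2 * INR k ^ 2
    + ((INR k * m * log_slope a b m x) ^ 2
       - 4 * a * b * m ^ 2 * INR k / fsum a b m x ^ 2).
Proof.
  intros Hf; rewrite scaled_slope_square by exact Hf.
  unfold potential; field; exact Hf.
Qed.

(** The coefficient of the equation whose solutions the factor of index [k] acts on; the
    shift by one avoids a potential of index [-1], which would be zero. *)
Definition rung (a b m lambda : C) (k : nat) (x : R) : C :=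
  match k with
  | O => lambda
  | S j => lambda - potential a b m j x
  end.

Lemma rung_riccati (a b m lambda : C) (k : nat) (x : R) :
  fsum a b m x <> 0 ->
  rung a b m lambda k x
  = lambda - m ^ 2 * INR k ^ 2
    + (4 * a * b * m ^ 2 * INR k / fsum a b m x ^ 2
       + (INR k * m * log_slope a b m x) ^ 2).
Proof.
  intros Hf; destruct k as [|k]; [|now apply potential_succ].
  simpl; field; exact Hf.
Qed.

Lemma solves_ladder_factor (a b m lambda : C) (I : R -> Prop) (k : nat) (y : R -> C) :
  open I -> (forall x, I x -> fsum a b m x <> 0) ->
  solves I (rung a b m lambda k) y ->
  solves I (rung a b m lambda (S k)) (ladder_factor a b m k y).
Proof.
  intros HI Hf Hy.
  apply solves_coefficient_ext with
    (2 := proj2 (darboux_step I (rung a b m lambda k) _ _ y _ HI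
      (fun x Hx => is_deriv_scaled_slope a b m (INR k) x (Hf x Hx))
      (fun x Hx => rung_riccati a b m lambda k x (Hf x Hx)) Hy)).
  intros x Hx; symmetry; now apply potential_same, Hf.
Qed.

Lemma solves_ladder (a b m lambda : C) (I : R -> Prop) (k : nat) (y : R -> C) :
  open I -> (forall x, I x -> fsum a b m x <> 0) ->
  solves I (fun _ => lambda) y ->
  solves I (rung a b m lambda (S k)) (ladder a b m k y).
Proof.
  intros HI Hf Hy; induction k as [|k IH]; simpl descending_product;
    now apply solves_ladder_factor.
Qed.

Lemma wronskian_ladder (a b m lambda : C) (I : R -> Prop) (n : nat) (u v : R -> C) :
  open I -> (forall x, I x -> fsum a b m x <> 0) ->
  solves I (fun _ => lambda) u -> solves I (fun _ => lambda) v ->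
  (forall k, (k <= n)%nat -> lambda <> m ^ 2 * INR k ^ 2) ->
  (forall x, I x -> wronskian u v x <> 0) ->
  forall x, I x -> wronskian (ladder a b m n u) (ladder a b m n v) x <> 0.
Proof.
  intros HI Hf Hu Hv Hl HW.
  assert (step : forall k w z x, lambda <> m ^ 2 * INR k ^ 2 -> I x ->
    solves I (rung a b m lambda k) w -> solves I (rung a b m lambda k) z ->
    wronskian w z x <> 0 ->
    wronskian (ladder_factor a b m k w) (ladder_factor a b m k z) x <> 0).
  { intros k w z x Hk Hx Hw Hz H; unfold ladder_factor.
    rewrite (wronskian_darboux I (rung a b m lambda k) _ _ w z _ HI
      (fun x Hx => is_deriv_scaled_slope a b m (INR k) x (Hf x Hx))
      (fun x Hx => rung_riccati a b m lambda k x (Hf x Hx)) Hw Hz x Hx).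
    apply Cmult_neq_0; [|exact H].
    intros E; apply Hk, Ceq_minus.
    replace (lambda - m ^ 2 * INR k ^ 2) with (- - (lambda - m ^ 2 * INR k ^ 2)) by ring.
    rewrite E; ring. }
  induction n as [|n IH]; intros x Hx; simpl descending_product.
  - now apply step; auto; apply Hl.
  - apply step; auto; try (now apply solves_ladder).
Qed.

(** Linearity of the ladder needs differentiable arguments; here they are solutions. *)
Lemma ladder_combination (a b m lambda : C) (I : R -> Prop) (n : nat)
    (u v y : R -> C) (c1 c2 : C) :
  open I -> (forall x, I x -> fsum a b m x <> 0) ->
  solves I (fun _ => lambda) u -> solves I (fun _ => lambda) v ->
  (forall x, I x -> y x = c1 * u x + c2 * v x) ->
  forall x, I x -> ladder a b m n y x = c1 * ladder a b m n u x + c2 * ladder a b m n v x.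
Proof.
  intros HI Hf Hu Hv Hy.
  assert (step : forall k q w z s, solves I q w -> solves I q z ->
    (forall x, I x -> s x = c1 * w x + c2 * z x) -> forall x, I x ->
    ladder_factor a b m k s x
    = c1 * ladder_factor a b m k w x + c2 * ladder_factor a b m k z x).
  { intros k q w z s Hw Hz Hs x Hx; unfold ladder_factor.
    rewrite (Cderiv_ext_open I s _ x HI Hx Hs), Hs by exact Hx.
    rewrite (is_deriv_Cderiv _ _ _ (is_deriv_plus _ _ _ _ _
      (is_deriv_scal c1 _ _ _ (proj1 (Hw x Hx))) (is_deriv_scal c2 _ _ _ (proj1 (Hz x Hx))))).
    ring. }
  induction n as [|n IH]; simpl descending_product.
  - now apply (step 0%nat (fun _ => lambda)).
  - apply (step (S n) (rung a b m lambda (S n))); auto; now apply solves_ladder.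
Qed.

Lemma power_operator_solution (a b m lambda : C) (I : R -> Prop) (n : nat) (y : R -> C) :
  open I -> (forall x, I x -> fsum a b m x <> 0) ->
  solves I (fun _ => lambda) y ->
  forall x, I x -> power_operator a b m n y x = ladder a b m n y x.
Proof.
  intros HI Hf Hy; apply power_operator_ladder; auto.
  - intros x Hx; exact (is_deriv_differentiable _ _ _ (proj1 (Hy x Hx))).
  - intros j x _ Hx.
    exact (is_deriv_differentiable _ _ _ (proj1 (solves_ladder a b m lambda I j y HI Hf Hy x Hx))).
Qed.

Lemma scalar_fsum (K : scalar_field) (a b m : C) (x : R) :
  is_scalar K a -> is_scalar K b -> is_scalar K m -> is_scalar K (fsum a b m x).
Proof. unfold fsum; auto 8 with scalars. Qed.

Lemma scalar_ladder (K : scalar_field) (a b m : C) (I : R -> Prop) (n : nat) (y : R -> C) :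
  open I -> is_scalar K a -> is_scalar K b -> is_scalar K m ->
  (forall x, I x -> is_scalar K (y x)) ->
  forall x, I x -> is_scalar K (ladder a b m n y x).
Proof.
  intros HI Ka Kb Km Ky.
  assert (step : forall k z, (forall x, I x -> is_scalar K (z x)) ->
    forall x, I x -> is_scalar K (ladder_factor a b m k z x)).
  { intros k z Kz x Hx; unfold ladder_factor, log_slope, fdiff.
    assert (is_scalar K (Cderiv z x)) by now apply (scalar_Cderiv K I).
    assert (is_scalar K (fsum a b m x)) by now apply scalar_fsum.
    auto 12 with scalars. }
  induction n as [|n IH]; simpl descending_product; auto.
Qed.

(** * The free equation *)

(** The hyperbolic ([e = 1]) and the trigonometric ([e = -1]) pair at once; the Wronskian
    is [r (g^2 - e h^2) = r]. *)
Lemma solves_real_pair (I : R -> Prop) (g h : R -> R) (e r : R) :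
  open I -> r <> 0%R ->
  (forall t, is_derive g t (e * h t)%R) -> (forall t, is_derive h t (g t)) ->
  (forall t, g t * g t - e * (h t * h t) = 1)%R ->
  let u := fun x : R => RtoC (g (r * x)%R) in
  let v := fun x : R => RtoC (h (r * x)%R) in
  solves I (fun _ => RtoC (e * (r * r))) u /\ solves I (fun _ => RtoC (e * (r * r))) v /\
  (forall x, I x -> wronskian u v x <> 0).
Proof.
  intros HI Hr Hg Hh Hgh u v.
  assert (D : forall (f f' : R -> R), (forall t, is_derive f t (f' t)) ->
    forall x, is_deriv (fun t : R => RtoC (f (r * t)%R)) x (RtoC (r * f' (r * x)%R))).
  { intros f f' Hf x; apply is_deriv_RtoC.
    apply (is_derive_comp f (fun t => r * t)%R); [apply Hf | auto_derive; auto; ring]. }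
  assert (Du := D _ _ Hg); assert (Dv := D _ _ Hh).
  split; [|split].
  - apply (solves_intro I _ u (fun x => RtoC (e * r) * v x)); auto; intros x _.
    + eapply is_deriv_eq; [apply Du | unfold v; rewrite <- RtoC_mult; f_equal; ring].
    + eapply is_deriv_eq; [apply is_deriv_scal, Dv|].
      unfold u; rewrite <- !RtoC_mult; f_equal; ring.
  - apply (solves_intro I _ v (fun x => RtoC r * u x)); auto; intros x _.
    + eapply is_deriv_eq; [apply Dv | unfold u; rewrite <- RtoC_mult; f_equal; ring].
    + eapply is_deriv_eq; [apply is_deriv_scal, Du|].
      unfold v; rewrite <- !RtoC_mult; f_equal; ring.
  - intros x _; unfold wronskian.
    unfold u, v; rewrite (is_deriv_Cderiv _ _ _ (Du x)), (is_deriv_Cderiv _ _ _ (Dv x)).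
    rewrite <- !RtoC_mult, <- RtoC_minus; intros H; apply RtoC_inj in H.
    apply Hr; rewrite <- (Rmult_1_r r), <- (Hgh (r * x)%R), <- H; ring.
Qed.

Lemma free_form_basis (K : scalar_field) (I : R -> Prop) (lambda : C) (Y0 : C -> C -> R -> C) :
  open I -> lambda <> 0 -> free_form K lambda Y0 ->
  exists u v : R -> C,
    (forall c1 c2 x, Y0 c1 c2 x = c1 * u x + c2 * v x) /\
    (forall x, is_scalar K (u x)) /\ (forall x, is_scalar K (v x)) /\
    solves I (fun _ => lambda) u /\ solves I (fun _ => lambda) v /\
    (forall x, I x -> wronskian u v x <> 0).
Proof.
  intros HI Hl [s Ks Hs|l Hl0 Pl|l Hl0 Pl].
  (* Here the Wronskian is [- 2 s]. *)
  - assert (s0 : s <> 0) by (intros ->; apply Hl; rewrite <- Hs; ring).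
    assert (D : forall r x, is_deriv (fun t : R => r * Cexp (r * t)) x (r ^ 2 * Cexp (r * x))).
    { intros r x; eapply is_deriv_eq; [apply is_deriv_scal, is_deriv_Cexp | ring]. }
    exists (fun x => Cexp (s * x)), (fun x => Cexp (- s * x)).
    split; [reflexivity|]; split; [auto with scalars|]; split; [auto with scalars|].
    split; [|split].
    + eapply solves_intro; [exact HI | intros x _; apply is_deriv_Cexp |].
      intros x _; eapply is_deriv_eq; [apply D | rewrite <- Hs; reflexivity].
    + eapply solves_intro; [exact HI | intros x _; apply is_deriv_Cexp |].
      intros x _; eapply is_deriv_eq; [apply D | rewrite <- Hs; ring].
    + intros x _; unfold wronskian.
      rewrite (is_deriv_Cderiv _ _ _ (is_deriv_Cexp s x)),
        (is_deriv_Cderiv _ _ _ (is_deriv_Cexp (- s) x)).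
      assert (E := Cexp_opp (s * x)).
      replace (- (s * x)) with (- s * x) in E by ring.
      replace (_ - _) with (- 2 * s * (Cexp (s * x) * Cexp (- s * x))) by ring.
      rewrite E, Cmult_1_r; apply Cmult_neq_0; [|exact s0].
      intros H; apply (f_equal Re) in H; simpl in H; lra.
  - exists (fun x : R => RtoC (cosh (sqrt l * x))), (fun x : R => RtoC (sinh (sqrt l * x))).
    split; [reflexivity|]; split; [auto with scalars|]; split; [auto with scalars|].
    assert (Pr := sqrt_lt_R0 l Pl).
    replace lambda with (RtoC (1 * (sqrt l * sqrt l)))
      by (rewrite Hl0, sqrt_sqrt by lra; f_equal; ring).
    apply solves_real_pair; auto; [lra | | |]; intros t.
    + rewrite Rmult_1_l; apply is_derive_Reals, derivable_pt_lim_cosh.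
    + apply is_derive_Reals, derivable_pt_lim_sinh.
    + assert (E : (exp t * exp (- t) = 1)%R) by (rewrite <- exp_plus, Rplus_opp_r; apply exp_0).
      unfold cosh, sinh; lra.
  - exists (fun x : R => RtoC (cos (sqrt (- l) * x))), (fun x : R => RtoC (sin (sqrt (- l) * x))).
    split; [reflexivity|]; split; [auto with scalars|]; split; [auto with scalars|].
    assert (Pr : (0 < sqrt (- l))%R) by (apply sqrt_lt_R0; lra).
    replace lambda with (RtoC (- (1) * (sqrt (- l) * sqrt (- l))))
      by (rewrite Hl0, sqrt_sqrt by lra; f_equal; ring).
    apply solves_real_pair; auto; [lra | | |]; intros t.
    + replace (- (1) * sin t)%R with (- sin t)%R by ring; apply is_derive_cos.
    + apply is_derive_sin.
    + assert (E := sin2_cos2 t); unfold Rsqr in E; lra.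
Qed.

(** * The equation with lambda = m^2 (n+1)^2 *)

(** For [h = (n+1) m t] the identities [q = h' + h^2] and [u' = h u] give [u'' = q u].  From
    [G' = u^(-2)] it follows that [v = u G] satisfies [v' = h v + 1/u], where the extra
    term contributes [h/u - h/u = 0] to [v'']. *)
Lemma solves_primitive_pair (a b m : C) (I : R -> Prop) (n : nat) (G : R -> C) :
  open I -> (forall x, I x -> fsum a b m x <> 0) ->
  (forall x, I x -> is_deriv G x (/ fsum a b m x ^ (2 * (n + 1)))) ->
  let q := fun x => m ^ 2 * (INR n + 1) ^ 2 - potential a b m n x in
  let u := fun x => fsum a b m x ^ (n + 1) in
  let v := fun x => fsum a b m x ^ (n + 1) * G x in
  solves I q u /\ solves I q v /\ (forall x, I x -> wronskian u v x = 1).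
Proof.
  intros HI Hf HG q u v.
  set (c := RtoC (INR (S n))).
  set (h := fun x => c * m * log_slope a b m x).
  assert (Hq : forall x, I x ->
    q x = 4 * a * b * m ^ 2 * c / fsum a b m x ^ 2 + h x ^ 2).
  { intros x Hx; unfold q; rewrite potential_succ by auto.
    fold c; fold (h x); unfold c; rewrite S_INR, RtoC_plus; ring. }
  assert (Hh : forall x, I x -> is_deriv h x (4 * a * b * m ^ 2 * c / fsum a b m x ^ 2))
    by (intros x Hx; apply is_deriv_scaled_slope; auto).
  assert (Du : forall x, I x -> is_deriv u x (h x * u x)).
  { intros x Hx; unfold u; rewrite Nat.add_1_r.
    eapply is_deriv_eq; [apply is_deriv_pow, is_deriv_fsum|].
    unfold h, c, log_slope; rewrite Cpow_S; field; auto. }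
  assert (u0 : forall x, I x -> u x <> 0) by (intros x Hx; apply Cpow_nz; auto).
  assert (HG' : forall x, I x -> is_deriv G x (/ (u x * u x))).
  { intros x Hx; eapply is_deriv_eq; [exact (HG x Hx)|].
    rewrite Nat.mul_comm, Cpow_mult_r; f_equal; unfold u; ring. }
  assert (Dv : forall x, I x -> is_deriv v x (h x * v x + / u x)).
  { intros x Hx; eapply is_deriv_eq; [exact (is_deriv_mult _ _ _ _ _ (Du x Hx) (HG' x Hx))|].
    unfold v; fold (u x); field; auto. }
  split; [|split].
  - apply (solves_intro I q u _ HI Du); intros x Hx.
    eapply is_deriv_eq; [exact (is_deriv_mult _ _ _ _ _ (Hh x Hx) (Du x Hx))|].
    rewrite Hq by exact Hx; ring.
  - apply (solves_intro I q v _ HI Dv); intros x Hx.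
    eapply is_deriv_eq; [exact (is_deriv_plus _ _ _ _ _
      (is_deriv_mult _ _ _ _ _ (Hh x Hx) (Dv x Hx))
      (is_deriv_inv _ _ _ (u0 x Hx) (Du x Hx)))|].
    rewrite Hq by exact Hx; field; auto.
  - intros x Hx; unfold wronskian.
    rewrite (is_deriv_Cderiv _ _ _ (Du x Hx)), (is_deriv_Cderiv _ _ _ (Dv x Hx)).
    unfold v; fold (u x); field; auto.
Qed.

(** * The theorem *)

Theorem mainTheorem3 :
  forall (K : scalar_field) (n : nat) (a b m : C) (lo hi : Rbar),
    (1 <= n)%nat ->
    is_scalar K a -> is_scalar K b -> is_scalar K m ->
    let I := Rbar_interval lo hi in
    (forall x : R, I x -> fsum a b m x <> 0) ->
    (* the operational identity *)
    (forall y : R -> C, differentiable_n (n + 1) I y ->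
       forall x : R, I x ->
         descending_product
           (fun k z t => Cderiv z t - INR k * m * (fdiff a b m t / fsum a b m t) * z t) n y x
         = power_operator a b m n y x)
    /\
    (* (i); the side condition of its last clause is needed for completeness only *)
    (forall lambda : C, is_scalar K lambda -> lambda <> 0 ->
       forall Y0 : C -> C -> R -> C, free_form K lambda Y0 ->
         let L := fun y x => Cderiv (Cderiv y) x - (lambda - potential a b m n x) * y x in
         let Yn := fun c1 c2 => power_operator a b m n (Y0 c1 c2) in
         general_solution K I (fun y x => Cderiv (Cderiv y) x - lambda * y x) Y0 /\
         family_of_solutions K I L Yn /\
         ((forall k : nat, (1 <= k <= n)%nat -> lambda <> m ^ 2 * INR k ^ 2) ->
          general_solution K I L Yn))
    /\
    (* (ii), the factorization *)
    (forall y : R -> C, differentiable_n 2 I y ->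
       forall x : R, I x ->
         let h := fun t : R => m * (INR n + 1) * (fdiff a b m t / fsum a b m t) in
         let z := fun t : R => Cderiv y t - h t * y t in
         Cderiv (Cderiv y) x - m ^ 2 * (INR n + 1) ^ 2 * y x + potential a b m n x * y x
         = Cderiv z x + h x * z x)
    /\
    (* (ii), the general solution *)
    (forall G : R -> C,
       primitive_on K I (fun x => / fsum a b m x ^ (2 * (n + 1))) G ->
       general_solution K I
         (fun y x => Cderiv (Cderiv y) x - m ^ 2 * (INR n + 1) ^ 2 * y x + potential a b m n x * y x)
         (fun c1 c2 x => fsum a b m x ^ (n + 1) * (c1 + c2 * G x))).

Proof.
  intros K n a b m lo hi _ Ka Kb Km I Hf.
  assert (HI : open I) by apply open_Rbar_interval.
  split; [|split; [|split]].
  - intros y Hy x Hx; symmetry.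
    apply (power_operator_ladder a b m I n y HI Hf); auto.
    + intros t Ht; apply (Hy 0%nat); [lia | exact Ht].
    + intros j t Hj Ht.
      assert (D : differentiable_n 1 I (ladder a b m j y)).
      { apply differentiable_n_ladder; auto.
        intros i s Hi; apply Hy; lia. }
      apply (D 0%nat); [lia | exact Ht].
  - intros lambda Kl Hl Y0 HY0 L Yn.
    destruct (free_form_basis K I lambda Y0 HI Hl HY0)
      as (u & v & EY & Ku & Kv & Hu & Hv & HW).
    assert (HL : forall z x, I x ->
      L z x = Cderiv (Cderiv z) x - rung a b m lambda (S n) x * z x)
      by reflexivity.
    assert (Kun := scalar_ladder K a b m I n u HI Ka Kb Km (fun x _ => Ku x)).
    assert (Kvn := scalar_ladder K a b m I n v HI Ka Kb Km (fun x _ => Kv x)).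
    assert (Hun := solves_ladder a b m lambda I n u HI Hf Hu).
    assert (Hvn := solves_ladder a b m lambda I n v HI Hf Hv).
    assert (EYn : forall c1 c2 x, I x ->
      Yn c1 c2 x = c1 * ladder a b m n u x + c2 * ladder a b m n v x).
    { intros c1 c2 x Hx; unfold Yn.
      rewrite (power_operator_solution a b m lambda I n _ HI Hf) by
        (try exact Hx;
         apply (solves_ext I _ (fun x => c1 * u x + c2 * v x)); auto;
         now apply solves_combination).
      now apply (ladder_combination a b m lambda I n u v). }
    split; [|split].
    + apply (general_solution_of_pair K lo hi _ (fun _ => lambda) u v); auto.
    + now apply (family_of_pair K I L _ _ _ Yn HI HL Kun Kvn Hun Hvn).
    + intros Hk.
      apply (general_solution_of_pair K lo hi L _ _ _ Yn HL Kun Kvn Hun Hvn); auto.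
      apply (wronskian_ladder a b m lambda I n u v HI Hf Hu Hv); auto.
      (* The factor of index 0 contributes the condition [lambda <> 0]. *)
      intros [|k] Hkn; [|apply Hk; lia].
      intros E; apply Hl; rewrite E; simpl INR; ring.
  - intros y Hy x Hx h z.
    assert (Hh : forall t, I t ->
      is_deriv h t (4 * a * b * m ^ 2 * INR (S n) / fsum a b m t ^ 2)).
    { intros t Ht; apply (is_deriv_ext_open I
        (fun t => INR (S n) * m * log_slope a b m t)); auto.
      - intros s _; unfold h, log_slope; rewrite S_INR, RtoC_plus; ring.
      - apply is_deriv_scaled_slope; auto. }
    etransitivity; [|exact (factorization I h _ y Hh Hy x Hx)].
    assert (P := potential_succ a b m n (m ^ 2 * INR (S n) ^ 2) x (Hf x Hx)).
    replace (h x) with (INR (S n) * m * log_slope a b m x)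
      by (unfold h, log_slope; rewrite S_INR, RtoC_plus; ring).
    replace (_ / _ + _) with (m ^ 2 * INR (S n) ^ 2 - potential a b m n x)
      by (rewrite P; ring).
    rewrite S_INR, RtoC_plus; ring.
  - intros G HG.
    destruct (solves_primitive_pair a b m I n G HI Hf (fun x Hx => proj2 (HG x Hx)))
      as (Hu & Hv & HW).
    assert (Ku : forall x, I x -> is_scalar K (fsum a b m x ^ (n + 1)))
      by (intros x Hx; now apply scalar_pow, scalar_fsum).
    eapply (general_solution_of_pair K lo hi); [| | | exact Hu | exact Hv | |].
    + intros z x _; simpl; ring.
    + exact Ku.
    + intros x Hx; apply scalar_mult; [auto | now apply HG].
    + intros x Hx; rewrite HW by exact Hx; exact C1_nz.
    + intros c1 c2 x _; simpl; ring.
Qed.
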